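(* Let $N(\cdot)$ be a unitarily invariant norm on $M_n(\mathbb{C})$, let $A\in M_n(\mathbb{C})$ be positive definite and let $X\in M_n(\mathbb{C})$ be arbitrary. Then each of the functions $$f(t)=w_N\big(A^{t}XA^{1-t}+A^{1-t}XA^{t}\big)\qquad\text{and}\qquad g(t)=w_N\big(A^{t}XA^{1-t}\big)$$ is convex on $\mathbb{R}$.
   Context: For a norm $N$ on $M_n(\mathbb{C})$ (the $n\times n$ complex matrices), the generalized numerical radius of $Y\in M_n(\mathbb{C})$ is $w_N(Y)=\sup_{\theta\in\mathbb{R}}N(\mathrm{Re}(e^{i\theta}Y))$, where $\mathrm{Re}(Z)=\frac12(Z+Z^* )$. The norm $N$ is unitarily invariant if $N(UYV)=N(Y)$ for all $Y\in M_n(\mathbb{C})$ and all unitary $U,V\in M_n(\mathbb{C})$. For a positive definite (Hermitian) matrix $A$ and $t\in\mathbb{R}$, $A^t$ is defined by the functional calculus. *)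

(* Defs.v *)
From mathcomp Require Import all_boot all_order all_algebra.
From mathcomp Require Import complex.
From mathcomp Require Import all_classical all_reals all_analysis.

Set Implicit Arguments.
Unset Strict Implicit.
Unset Printing Implicit Defensive.

Import Order.TTheory GRing.Theory Num.Theory.

Local Open Scope classical_set_scope.
Local Open Scope ring_scope.
Local Open Scope complex_scope.
Local Open Scope sesquilinear_scope.

(* `|a| : R[i] is the modulus of a embedded in R[i]; complex.Re brings it back
   to R. *)
Record is_norm (R : realType) (n : nat) (N : 'M[R[i]]_n -> R) : Prop := IsNorm {
  norm_ge0 : forall Y, 0 <= N Y ;
  norm_eq0 : forall Y, N Y = 0 -> Y = 0 ;
  normZ : forall (a : R[i]) Y, N (a *: Y) = complex.Re `|a| * N Y ;
  norm_triangle : forall Y Z, N (Y + Z) <= N Y + N Z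
}.

Definition unitarily_invariant (R : realType) (n : nat)
    (N : 'M[R[i]]_n -> R) : Prop :=
  forall Y U V : 'M[R[i]]_n,
    U \is unitarymx -> V \is unitarymx -> N (U *m Y *m V) = N Y.

(* The order of R[i] makes 0 < z mean that z is real and positive. *)
Definition posdefmx (R : realType) (n : nat) (A : 'M[R[i]]_n) : Prop :=
  A \is hermsymmx /\
  forall x : 'cV[R[i]]_n, x != 0 -> 0 < (x ^t* *m A *m x) 0 0.

Definition Remx (R : realType) (n : nat) (Z : 'M[R[i]]_n) : 'M[R[i]]_n :=
  2^-1 *: (Z + Z ^t*).

Definition expi (R : realType) (theta : R) : R[i] := cos theta +i* sin theta.

Definition gen_num_radius (R : realType) (n : nat) (N : 'M[R[i]]_n -> R)
    (Y : 'M[R[i]]_n) : R :=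
  sup (range (fun theta : R => N (Remx (expi theta *: Y)))).

(* Functional calculus f(A) of a Hermitian matrix A = P^* diag(d) P, with P
   unitary and d the (real) spectrum of A. *)
Definition fun_calc (R : realType) (n : nat) (f : R -> R)
    (A : 'M[R[i]]_n) : 'M[R[i]]_n :=
  (spectralmx A) ^t*
    *m diag_mx (map_mx (fun z => (f (complex.Re z))%:C) (spectral_diag A))
    *m spectralmx A.

Definition mxpow (R : realType) (n : nat) (A : 'M[R[i]]_n) (t : R) :
    'M[R[i]]_n :=
  fun_calc (fun x => x `^ t) A.

(* Main.v *)
Require Import Defs.
From mathcomp Require Import all_boot all_order all_algebra all_fingroup.
From mathcomp Require Import complex.
From mathcomp Require Import all_classical all_reals all_analysis.
From mathcomp Require Import ring lra.

(** Write [F t] for either of the two matrix families.  Then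
    [F (m + h) + F (m - h) = A^h F(m) A^-h + A^-h F(m) A^h], and the same holds
    for [S = Re (e^(i theta) F m)].  For Hermitian [S] and positive [B] one has
    [2 N(S) <= N (B S B^-1 + B^-1 S B)]: Schur triangularization
    [B S B^-1 = U^* T U] puts the real eigenvalues of [S] on the diagonal of
    [Re T], and [N] does not increase when off-diagonal entries are erased.
    Hence both functions are midpoint convex; being bounded on bounded
    intervals, they are convex. *)

Set Implicit Arguments.
Unset Strict Implicit.
Unset Printing Implicit Defensive.

Import Order.TTheory GRing.Theory Num.Theory.

Local Open Scope classical_set_scope.
Local Open Scope ring_scope.
Local Open Scope complex_scope.
Local Open Scope sesquilinear_scope.

(** * Adjoints, characteristic polynomials and permutation matrices *)

Section Adjoint.
Variable C : numClosedFieldType.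

Lemma adjmxM m n p (A : 'M[C]_(m, n)) (B : 'M[C]_(n, p)) :
  (A *m B) ^t* = B ^t* *m A ^t*.
Proof. by rewrite trmx_mul map_mxM. Qed.

Lemma adjmxMM m n p q (A : 'M[C]_(m, n)) (B : 'M[C]_(n, p)) (D : 'M[C]_(p, q)) :
  (A *m B *m D) ^t* = D ^t* *m B ^t* *m A ^t*.
Proof. by rewrite !adjmxM mulmxA. Qed.

Lemma adjmxD m n (A B : 'M[C]_(m, n)) : (A + B) ^t* = A ^t* + B ^t*.
Proof. by rewrite linearD map_mxD. Qed.

Lemma adjmxZ m n (a : C) (A : 'M[C]_(m, n)) : (a *: A) ^t* = a^* *: A ^t*.
Proof. by rewrite linearZ map_mxZ. Qed.

Lemma hermsymmxP n (A : 'M[C]_n) : reflect (A ^t* = A) (A \is hermsymmx).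
Proof.
by apply: (iffP (is_hermitianmxP _ _ _)); rewrite expr0 scale1r => /esym.
Qed.

Lemma adjmx_herm_mulmx n (A B X : 'M[C]_n) :
  A ^t* = A -> B ^t* = B -> (A *m X *m B) ^t* = B *m X ^t* *m A.
Proof. by move=> hA hB; rewrite adjmxMM hA hB. Qed.

Lemma char_poly_similar n (P Q A : 'M[C]_n) :
  P *m Q = 1%:M -> char_poly (P *m A *m Q) = char_poly A.
Proof.
move=> PQ; have PQ' : map_mx polyC P *m map_mx polyC Q = 1%:M.
  by rewrite -map_mxM PQ map_mx1.
rewrite /char_poly.
have -> : char_poly_mx (P *m A *m Q) =
    map_mx polyC P *m char_poly_mx A *m map_mx polyC Q.
  rewrite /char_poly_mx !map_mxM mulmxBr mulmxBl; congr (_ - _).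
  by rewrite scalar_mxC -mulmxA PQ' mulmx1.
by rewrite !det_mulmx mulrAC -det_mulmx PQ' det1 mul1r.
Qed.

Lemma perm_mx_unitary n (s : 'S_n) : perm_mx s \is @unitarymx C n n.
Proof.
by apply/unitarymxP; rewrite tr_perm_mx map_perm_mx -perm_mxM mulgV perm_mx1.
Qed.

Lemma diag_mx_perm n (s : 'S_n) (d : 'rV[C]_n) :
  perm_mx s *m diag_mx d *m (perm_mx s) ^t* = diag_mx (\row_i d 0 (s i)).
Proof.
rewrite tr_perm_mx map_perm_mx -row_permE -col_permE.
by apply/matrixP => i j; rewrite !mxE (can_eq (permK _)).
Qed.

(** Unique factorization into linear factors turns equality of characteristic polynomials into a
    relabelling of eigenvalues. *)
Lemma prod_XsubC_perm n (d e : 'I_n -> C) :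
  \prod_i ('X - (d i)%:P) = \prod_i ('X - (e i)%:P) ->
  exists s : 'S_n, forall i, d i = e (s i).
Proof.
pose t (f : 'I_n -> C) := [tuple f i | i < n].
have tE (f : 'I_n -> C) :
    \prod_i ('X - (f i)%:P) = \prod_(x <- t f) ('X - x%:P).
  by rewrite big_tuple; apply: eq_bigr => i _; rewrite tnth_mktuple.
rewrite !tE => /prod_XsubC_eq /tuple_permP[s ets]; exists s => i.
by have /val_inj /(congr1 (fun u => tnth u i)) := ets; rewrite !tnth_mktuple.
Qed.

End Adjoint.

(** * Real powers of a positive definite matrix *)

Section MatrixPower.
Variables (R : realType) (n : nat) (A : 'M[R[i]]_n).

Lemma mxpow_adj (t : R) : (mxpow A t) ^t* = mxpow A t.
Proof.
rewrite /mxpow /fun_calc adjmxMM trmxCK tr_diag_mx map_diag_mx.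
congr (_ *m diag_mx _ *m _); apply/rowP => i; rewrite !mxE /=.
by apply: conj_Creal; rewrite complex_real.
Qed.

Lemma mxpow0 : mxpow A 0 = 1%:M.
Proof.
rewrite /mxpow /fun_calc.
have -> : map_mx (fun z => (complex.Re z `^ 0)%:C) (spectral_diag A) = const_mx 1.
  by apply/rowP => i; rewrite !mxE powRr0.
by rewrite diag_const_mx mulmx1; apply/mulmx1C/unitarymxP/spectral_unitarymx.
Qed.

(** Isolates the dependence on [t] in scalar coefficients, for bounds on bounded intervals. *)
Lemma mxpow_spectral_sum (t : R) : mxpow A t =
  \sum_i (complex.Re (spectral_diag A 0 i) `^ t)%:C *:
    ((spectralmx A) ^t* *m delta_mx i i *m spectralmx A).
Proof.
rewrite /mxpow /fun_calc diag_mx_sum_delta mulmx_sumr mulmx_suml.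
by apply: eq_bigr => i _; rewrite mxE -scalemxAr -scalemxAl.
Qed.

Hypothesis posA : posdefmx A.

Lemma spectral_diag_gt0 i : 0 < complex.Re (spectral_diag A 0 i).
Proof.
have [Aherm Apos] := posA.
have /orthomx_spectralP := hermitian_normalmx Aherm.
have := spectral_unitarymx A; set P := spectralmx A => Pu AE.
rewrite invmx_unitary// in AE.
(* A unit eigenvector: the quadratic form of [A] at [x] is the [i]-th eigenvalue. *)
pose x : 'cV[R[i]]_n := P ^t* *m delta_mx i 0.
have Px : P *m x = delta_mx i 0 by rewrite mulmxA (unitarymxP Pu) mul1mx.
have x0 : x != 0.
  apply/eqP => x0; move/matrixP/(_ i 0): Px; rewrite x0 mulmx0 !mxE !eqxx.
  by move=> /esym/eqP; rewrite oner_eq0.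
have := Apos x x0.
have -> : x ^t* *m A *m x = (P *m x) ^t* *m diag_mx (spectral_diag A) *m (P *m x).
  by rewrite adjmxM {1}AE !mulmxA.
rewrite Px trmx_delta map_delta_mx -rowE -colE !mxE eqxx mulr1n.
by rewrite ltcE => /andP[].
Qed.

Lemma mxpowD (s t : R) : mxpow A (s + t) = mxpow A s *m mxpow A t.
Proof.
rewrite /mxpow /fun_calc.
move: (spectralmx A) (spectral_unitarymx A) => P Pu.
rewrite !mulmxA (mulmxtVK _ Pu).
rewrite -[X in _ = X *m _]mulmxA mulmx_diag.
congr (_ *m diag_mx _ *m _); apply/rowP => i; rewrite !mxE.
(* The exponent law can fail at base 0 when the exponents cancel; positive eigenvalues exclude
   this. *)
by rewrite -rmorphM -powRD// (gt_eqF (spectral_diag_gt0 i)) implybT.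
Qed.

Lemma mxpowN (t : R) : mxpow A t *m mxpow A (- t) = 1%:M.
Proof. by rewrite -mxpowD subrr mxpow0. Qed.

Lemma mxpow_shift (X : 'M[R[i]]_n) (s t u v h k : R) :
  s = h + t -> u = v + k ->
  mxpow A s *m X *m mxpow A u =
  mxpow A h *m (mxpow A t *m X *m mxpow A v) *m mxpow A k.
Proof.
move=> -> ->; rewrite (mxpowD h) (mxpowD v).
by move: (mxpow A h) (mxpow A t) (mxpow A v) (mxpow A k) => *; rewrite !mulmxA.
Qed.

End MatrixPower.

(** * Real powers on an interval, and midpoint convexity *)

Lemma powR_le_add (R : realType) (x a b t : R) :
  0 < x -> a <= t <= b -> x `^ t <= x `^ a + x `^ b.
Proof.
move=> x0 /andP[at_ tb]; have [x1|x1] := leP 1 x.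
  by rewrite ler_wpDl ?powR_ge0// ler_powR.
by rewrite ler_wpDr ?powR_ge0// ger_powR// x0 ltW.
Qed.

(** Boundedness from above replaces continuity: it makes the supremum of the gap [h] between [f] and
    its chord finite, and midpoint convexity then forces this supremum to be nonpositive. *)
Lemma midpoint_convex_function (R : realType) (f : R -> R) :
  (forall m h, f m <= 2^-1 * (f (m + h) + f (m - h))) ->
  (forall a b, exists M, forall t, a <= t <= b -> f t <= M) ->
  convex_function (E := R^o) setT f.
Proof.
move=> fmidh fbnd p x y _ _.
have fmid s t : f (2^-1 * (s + t)) <= 2^-1 * (f s + f t).
  have := fmidh (2^-1 * (s + t)) (2^-1 * (s - t)).
  have -> : 2^-1 * (s + t) + 2^-1 * (s - t) = s by field.
  by have -> : 2^-1 * (s + t) - 2^-1 * (s - t) = t by field.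
rewrite !convRE /unstable.onem.
pose c (l : R) := l * x + (1 - l) * y.
pose h l := f (c l) - (l * f x + (1 - l) * f y).
have [M fM] := fbnd (Num.min x y) (Num.max x y).
pose H := [set h l | l in [set l : R | 0 <= l <= 1]].
have ubH : has_ubound H.
  exists (M + `|f x| + `|f y|) => _ [l /= /andP[l0 l1] <-].
  rewrite /h -addrA; apply: lerD.
    apply: fM; rewrite /c ge_min le_max; have [xy|/ltW xy] := leP x y.
      by apply/andP; split; apply/orP; [left|right]; nra.
    by apply/andP; split; apply/orP; [right|left]; nra.
  rewrite opprD; have := ler_norm (- f x); have := ler_norm (- f y).
  rewrite !normrN => hy hx; have := normr_ge0 (f x); have := normr_ge0 (f y).
  by move=> *; apply: lerD; nra.
have hH l : 0 <= l <= 1 -> h l <= sup H.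
  by move=> l01; apply: ub_le_sup => //; exists l.
(* At the endpoints [h] vanishes, so its supremum is at most its own half. *)
have half l : 0 <= l <= 1 -> h l <= 2^-1 * sup H.
  move=> /andP[l0 l1]; have [lh|/ltW lh] := leP l 2^-1.
    (* Here [c l] is the midpoint of [y = c 0] and [c (2 * l)]; for larger [l], of [x = c 1] and
       [c (2 * l - 1)]. *)
    have := hH (2 * l); have := fmid y (c (2 * l)).
    have -> : 2^-1 * (y + c (2 * l)) = c l by rewrite /c; field.
    rewrite /h => fl H2; have : 0 <= 2 * l <= 1 by apply/andP; split; lra.
    move=> /H2; lra.
  have := hH (2 * l - 1); have := fmid x (c (2 * l - 1)).
  have -> : 2^-1 * (x + c (2 * l - 1)) = c l by rewrite /c; field.
  rewrite /h => fl H2; have : 0 <= 2 * l - 1 <= 1 by apply/andP; split; lra.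
  move=> /H2; lra.
have supH : sup H <= 2^-1 * sup H.
  apply: ge_sup; last by move=> _ [l l01 <-]; exact: half.
  by exists (h 0), 0 => //=; rewrite lexx ler01.
have p01 : 0 <= p%:num <= 1 by rewrite ge0 le1.
by have := hH _ p01; rewrite /h /c; lra.
Qed.

(** * Unitarily invariant norms and pinching *)

Section UnitarilyInvariantNorm.
Variables (R : realType) (n : nat) (N : 'M[R[i]]_n -> R).
Hypotheses (normN : is_norm N) (uiN : unitarily_invariant N).

Lemma norm_scaleC (a : R) (Y : 'M[R[i]]_n) : 0 <= a -> N (a%:C *: Y) = a * N Y.
Proof. by move=> a0; rewrite (normZ normN) ger0_norm ?ler0c. Qed.

Lemma norm_half (Y : 'M[R[i]]_n) : N (2^-1 *: Y) = 2^-1 * N Y.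
Proof.
have -> : 2^-1 = (2^-1 : R)%:C :> R[i] by rewrite fmorphV rmorph_nat.
by rewrite norm_scaleC// invr_ge0.
Qed.

Lemma norm0 : N 0 = 0.
Proof. by rewrite -(scale0r (0 : 'M[R[i]]_n)) (normZ normN) normr0 mul0r. Qed.

Lemma norm_sum (I : Type) (r : seq I) (P : pred I) (F : I -> 'M[R[i]]_n) :
  N (\sum_(i <- r | P i) F i) <= \sum_(i <- r | P i) N (F i).
Proof.
elim/big_ind2: _ => [|x1 x2 y1 y2 h1 h2|//]; first by rewrite norm0.
by apply: le_trans (norm_triangle normN _ _) _; rewrite lerD.
Qed.

(** Interpolates between [M] at [k = 0] and its diagonal part at [k = n], one row and column at a
    time. *)
Let pinch (k : nat) (M : 'M[R[i]]_n) : 'M[R[i]]_n :=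
  \matrix_(i, j) if (i != j) && (minn i j < k)%N then 0 else M i j.

Let flip (k : nat) : 'rV[R[i]]_n :=
  \row_i (if i == k :> nat then -1 else 1).

(* Conjugating by the reflection that changes the sign of coordinate [k] and
   averaging kills the off-diagonal entries of row and column [k]. *)
Let pinchS k M : pinch k.+1 M =
  2^-1 *: (pinch k M + diag_mx (flip k) *m pinch k M *m diag_mx (flip k)).
Proof.
apply/matrixP => i j; rewrite mul_diag_mx mul_mx_diag !mxE.
have [<-{j}|neq_ij] /= := eqVneq i j.
  have -> : (if i == k :> nat then -1 else 1) * M i i *
      (if i == k :> nat then -1 else 1) = M i i.
    by case: ifP => _; ring.
  by field.
rewrite !gtn_min !ltnS.
have neq_ijn : (i : nat) <> j by move=> /val_inj/eqP; rewrite (negPf neq_ij).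
case: (ltngtP i k) => ik; case: (ltngtP j k) => jk //=; try by field.
by case: neq_ijn; rewrite ik jk.
Qed.

Let flip_unitary k : diag_mx (flip k) \is unitarymx.
Proof.
apply/unitarymxP; rewrite tr_diag_mx map_diag_mx mulmx_diag.
apply/matrixP => i j; rewrite !mxE.
by case: eqP => _; rewrite ?rmorphN1 ?rmorph1 ?mulrNN mulr1.
Qed.

(** Each pinching step averages two matrices of equal norm, by unitary invariance. *)
Lemma norm_diag_le (M : 'M[R[i]]_n) : N (diag_mx (\row_i M i i)) <= N M.
Proof.
have pinch_le k : N (pinch k M) <= N M.
  elim: k => [|k IHk].
    suff -> : pinch 0 M = M by [].
    by apply/matrixP => i j; rewrite mxE andbF.
  rewrite pinchS norm_half; apply: le_trans IHk; rewrite ler_pdivrMl//.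
  apply: le_trans (norm_triangle normN _ _) _.
  by rewrite uiN ?flip_unitary// mulr_natl mulr2n.
suff -> : diag_mx (\row_i M i i) = pinch n M by [].
apply/matrixP => i j; rewrite !mxE; have [->|neq_ij] /= := eqVneq i j.
  by rewrite mulr1n.
by rewrite gtn_min ltn_ord.
Qed.

Lemma norm_perm_diag (d e : 'rV[R[i]]_n) :
  \prod_i ('X - (d 0 i)%:P) = \prod_i ('X - (e 0 i)%:P) ->
  N (diag_mx d) = N (diag_mx e).
Proof.
move=> /prod_XsubC_perm[s de].
have -> : d = \row_i e 0 (s i) by apply/rowP => i; rewrite mxE de.
by rewrite -diag_mx_perm uiN ?trmxC_unitary ?perm_mx_unitary.
Qed.

(* [B S B^-1] is unitarily similar to a triangular matrix whose diagonal
   consists of the eigenvalues of [S]; these are real, so they form the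
   diagonal of its real part as well, and pinching that real part can only
   decrease the norm. *)
Lemma norm_le_symmetrized_conj (S B B' : 'M[R[i]]_n) :
  S \is hermsymmx -> B ^t* = B -> B' ^t* = B' -> B *m B' = 1%:M ->
  2 * N S <= N (B *m S *m B' + B' *m S *m B).
Proof.
move=> Sherm Bherm B'herm BB'.
have /orthomx_spectralP := hermitian_normalmx Sherm.
set Q := spectralmx S; set d := spectral_diag S => SE.
have Qu : Q \is unitarymx by exact: spectral_unitarymx.
have /mxOverP dreal := hermitian_spectral_diag_real Sherm.
rewrite invmx_unitary// in SE.
pose Z := B *m S *m B'.
have ZE : Z ^t* = B' *m S *m B.
  by rewrite adjmxMM Bherm B'herm (hermsymmxP _ Sherm).
have [P Pu Ptrig] : exists2 P : 'M[R[i]]_n, P \is unitarymx & similar_trig P Z.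
  (* Schur's theorem, as the simultaneous triangularization of [Z] with itself. *)
  have [] := @cotrigonalization2 _ _ Z Z erefl.
  by move=> P Pu /andP[? _]; exists P.
rewrite /similar_to conjymx// in Ptrig; set T := P *m Z *m P ^t* in Ptrig.
have charT : char_poly T = char_poly (diag_mx d).
  rewrite char_poly_similar; last exact/unitarymxP.
  by rewrite (char_poly_similar _ BB') SE char_poly_similar//;
    exact/mulmx1C/unitarymxP.
rewrite !char_poly_trig ?diag_mx_is_trig// in charT.
have charT' : \prod_(i < n) ('X - (T i i)%:P) = \prod_(i < n) ('X - (d 0 i)%:P).
  by rewrite charT; apply: eq_bigr => i _; rewrite mxE eqxx mulr1n.
have Treal i : (T i i)^* = T i i.
  have [s /(_ i) ->] := prod_XsubC_perm charT'.
  exact/conj_Creal/dreal.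
have NS : N S = N (diag_mx (\row_i T i i)).
  have -> : N S = N (diag_mx d).
    by rewrite [in LHS]SE (uiN _ _ Qu) ?trmxC_unitary.
  apply: norm_perm_diag.
  by rewrite -charT'; apply: eq_bigr => i _; rewrite [in RHS]mxE.
rewrite -/Z -ZE -(uiN (Z + Z ^t*) Pu (V := P ^t*)) ?trmxC_unitary//.
have -> : P *m (Z + Z ^t*) *m P ^t* = T + T ^t*.
  by rewrite mulmxDr mulmxDl /T !adjmxM trmxCK !mulmxA.
rewrite NS; clearbody T; apply: le_trans (norm_diag_le _).
rewrite -ler_pdivlMl// -norm_half.
(* The diagonal of [T] is real, so it is also that of the real part of [T]. *)
suff -> : \row_i T i i = 2^-1 *: (\row_i (T + T ^t*) i i).
  by rewrite linearZ.
by apply/rowP => i; rewrite !mxE [X in _ + X](Treal i); field.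
Qed.

(** * The generalized numerical radius *)

Lemma norm_expi (theta : R) : `|expi theta| = 1.
Proof. by rewrite normc_def /= cos2Dsin2 sqrtr1. Qed.

(** The bound is uniform in [theta], so the supremum in [gen_num_radius] is a genuine one and not
    the default value of [sup]. *)
Lemma norm_Remx_expi_le (theta : R) (Y : 'M[R[i]]_n) :
  N (Remx (expi theta *: Y)) <= 2^-1 * (N Y + N (Y ^t*)).
Proof.
rewrite norm_half ler_pM2l ?invr_gt0//.
apply: le_trans (norm_triangle normN _ _) _.
by rewrite adjmxZ !(normZ normN) norm_conjC norm_expi !mul1r.
Qed.

Lemma le_gen_num_radius (theta : R) (Y : 'M[R[i]]_n) :
  N (Remx (expi theta *: Y)) <= gen_num_radius N Y.
Proof.
apply: ub_le_sup; last by exists theta.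
by exists (2^-1 * (N Y + N (Y ^t*))) => _ [t _ <-]; exact: norm_Remx_expi_le.
Qed.

Lemma gen_num_radius_le (Y : 'M[R[i]]_n) (M : R) :
  (forall theta, N (Remx (expi theta *: Y)) <= M) -> gen_num_radius N Y <= M.
Proof.
move=> leM; apply: ge_sup; last by move=> _ [t _ <-].
by exists (N (Remx (expi 0 *: Y))), 0.
Qed.

Lemma RemxD (Y Z : 'M[R[i]]_n) : Remx (Y + Z) = Remx Y + Remx Z.
Proof. by rewrite /Remx adjmxD addrACA scalerDr. Qed.

Lemma Remx_hermsym (Y : 'M[R[i]]_n) : Remx Y \is hermsymmx.
Proof.
apply/hermsymmxP; rewrite /Remx adjmxZ adjmxD trmxCK addrC.
by rewrite conj_Creal// realV realn.
Qed.

Lemma gen_num_radiusD (Y Z : 'M[R[i]]_n) :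
  gen_num_radius N (Y + Z) <= gen_num_radius N Y + gen_num_radius N Z.
Proof.
apply: gen_num_radius_le => theta; rewrite scalerDr RemxD.
by apply: le_trans (norm_triangle normN _ _) _; rewrite lerD ?le_gen_num_radius.
Qed.

Lemma gen_num_radius_midpoint (B B' Y Y1 Y2 : 'M[R[i]]_n) :
  B ^t* = B -> B' ^t* = B' -> B *m B' = 1%:M ->
  Y1 + Y2 = B *m Y *m B' + B' *m Y *m B ->
  gen_num_radius N Y <= 2^-1 * (gen_num_radius N Y1 + gen_num_radius N Y2).
Proof.
move=> Bherm B'herm BB' Y12; apply: gen_num_radius_le => theta.
rewrite ler_pdivlMl//.
apply: le_trans (norm_le_symmetrized_conj (Remx_hermsym _) Bherm B'herm BB') _.
set e := expi theta.
(* Taking adjoints swaps the outer factors [B] and [B'], so the symmetrized conjugation commutes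
   with [Remx]. *)
have -> : B *m Remx (e *: Y) *m B' + B' *m Remx (e *: Y) *m B =
    Remx (e *: Y1) + Remx (e *: Y2).
  rewrite -RemxD -scalerDr Y12 /Remx !adjmxZ adjmxD !adjmxMM Bherm B'herm.
  rewrite -!scalemxAr -!scalemxAl -scalerDr; congr (_ *: _).
  rewrite !mulmxDr !mulmxDl -!scalemxAr -!scalemxAl !scalerDr.
  have addX (a b c d : 'M[R[i]]_n) : a + b + (c + d) = a + c + (d + b).
    by rewrite addrACA [b + d]addrC.
  exact: addX.
by apply: le_trans (norm_triangle normN _ _) _; rewrite lerD ?le_gen_num_radius.
Qed.

(** Expanding both powers spectrally leaves a finite sum of fixed matrices [E i *m X *m E j], whose
    coefficients are bounded by [powR_le_add]. *)
Lemma norm_mxpow_bounded (A X : 'M[R[i]]_n) (a b c d : R) : posdefmx A ->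
  exists M, forall s t, a <= s <= b -> c <= t <= d ->
    N (mxpow A s *m X *m mxpow A t) <= M.
Proof.
move=> posA.
pose l i := complex.Re (spectral_diag A 0 i).
pose E i := (spectralmx A) ^t* *m delta_mx i i *m spectralmx A.
exists (\sum_i \sum_j
  (l i `^ a + l i `^ b) * ((l j `^ c + l j `^ d) * N (E i *m X *m E j))).
move=> s t sab tcd.
rewrite [X in N X <= _](_ : _ =
    \sum_i \sum_j (l i `^ s)%:C *: ((l j `^ t)%:C *: (E i *m X *m E j))); last first.
  rewrite !mxpow_spectral_sum mulmx_suml mulmx_suml; apply: eq_bigr => i _.
  rewrite mulmx_sumr; apply: eq_bigr => j _.
  by rewrite -scalemxAr -!scalemxAl scalerA mulrC -scalerA.
apply: le_trans (norm_sum _ _ _) _; apply: ler_sum => i _.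
apply: le_trans (norm_sum _ _ _) _; apply: ler_sum => j _.
have li : 0 < l i by exact: spectral_diag_gt0.
have lj : 0 < l j by exact: spectral_diag_gt0.
rewrite !norm_scaleC ?powR_ge0//.
rewrite ler_pM ?powR_ge0 ?mulr_ge0 ?powR_ge0 ?(norm_ge0 normN) ?powR_le_add//.
by rewrite ler_wpM2r ?(norm_ge0 normN)// powR_le_add.
Qed.

Lemma gen_num_radius_mxpow_bounded (A X : 'M[R[i]]_n) (a b c d : R) :
  posdefmx A -> exists M, forall s t, a <= s <= b -> c <= t <= d ->
    gen_num_radius N (mxpow A s *m X *m mxpow A t) <= M.
Proof.
move=> posA; have [M1 M1P] := norm_mxpow_bounded X a b c d posA.
(* The adjoint swaps the two powers, hence the exchanged intervals. *)
have [M2 M2P] := norm_mxpow_bounded (X ^t*) c d a b posA.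
exists (2^-1 * (M1 + M2)) => s t sab tcd; apply: gen_num_radius_le => theta.
apply: le_trans (norm_Remx_expi_le _ _) _; rewrite ler_pM2l ?invr_gt0//.
apply: lerD; first exact: M1P.
by rewrite (adjmx_herm_mulmx _ (mxpow_adj A s) (mxpow_adj A t)); exact: M2P.
Qed.

End UnitarilyInvariantNorm.

(** * Convexity of the two families *)

(** For [f]: shifting [t] by [h] conjugates the two summands in opposite directions, so [B] and [B']
    trade places for [Z]. *)
Lemma symmetrized_conjD (R : realType) n
    (B B' Y Z Y1 Y2 Z1 Z2 : 'M[R[i]]_n) :
  Y1 = B *m Y *m B' -> Y2 = B' *m Y *m B ->
  Z1 = B' *m Z *m B -> Z2 = B *m Z *m B' ->
  Y1 + Z1 + (Y2 + Z2) = B *m (Y + Z) *m B' + B' *m (Y + Z) *m B.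
Proof.
move=> -> -> -> ->; rewrite !mulmxDr !mulmxDl.
by rewrite addrACA [B' *m Z *m B + _]addrC addrACA.
Qed.

Theorem theorem1p1 (R : realType) (n : nat) (N : 'M[R[i]]_n -> R)
    (A X : 'M[R[i]]_n) :
  is_norm N -> unitarily_invariant N -> posdefmx A ->
  convex_function (E := R^o) setT
    (fun t : R => gen_num_radius N
      (mxpow A t *m X *m mxpow A (1 - t) + mxpow A (1 - t) *m X *m mxpow A t))
  /\
  convex_function (E := R^o) setT
    (fun t : R => gen_num_radius N (mxpow A t *m X *m mxpow A (1 - t))).
Proof.
move=> normN uiN posA.
have opp1 (t a b : R) : a <= t <= b -> 1 - b <= 1 - t <= 1 - a.
  by move=> /andP[? ?]; rewrite !lerD2l !lerN2; apply/andP.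
split; apply: midpoint_convex_function.
- move=> m h.
  (* Take [B = A^h] and [B' = A^-h]; what remains is arithmetic of exponents. *)
  apply: (gen_num_radius_midpoint normN uiN (mxpow_adj A h) (mxpow_adj A (- h))).
    exact: mxpowN.
  by apply: symmetrized_conjD; apply: (mxpow_shift posA); ring.
- move=> a b.
  have [M1 M1P] := gen_num_radius_mxpow_bounded normN X a b (1 - b) (1 - a) posA.
  have [M2 M2P] := gen_num_radius_mxpow_bounded normN X (1 - b) (1 - a) a b posA.
  exists (M1 + M2) => t tab; apply: le_trans (gen_num_radiusD normN _ _) _.
  by apply: lerD; [apply: M1P|apply: M2P] => //; exact: opp1.
- move=> m h.
  apply: (gen_num_radius_midpoint normN uiN (mxpow_adj A h) (mxpow_adj A (- h))).
    exact: mxpowN.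
  by apply: f_equal2; apply: (mxpow_shift posA); ring.
- move=> a b.
  have [M MP] := gen_num_radius_mxpow_bounded normN X a b (1 - b) (1 - a) posA.
  by exists M => t tab; apply: MP => //; exact: opp1.
Qed.
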